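(* Let $\mathcal T$ consist of projective objects and be functorially finite in $\mathcal A$, and let $f:X\to Y$ be an epimorphism in $\mathcal A$. The following are equivalent: (1) $\overline f$ is both a strong monomorphism and a strong epimorphism in the pretriangulated category $\underline{\mathcal A}$; (2) $\ker(f)\in\mathcal T$ and, for some $\mathcal T$-preenvelope $\mu^X:X\to T^X$, $\mu^X(\ker f)$ is a direct summand of $T^X$; (3) $\ker(f)\in\mathcal T$ and there is a decomposition $f=[0\ \ f']:X=T'\oplus X'\to Y$ with $T'\in\mathcal T$ such that every morphism $h:X'\to T$ with $T\in\mathcal T$ vanishes on $\ker(f')$.
   Context: $\mathcal A$ is abelian, $\mathcal T$ a full additive subcategory closed under finite direct sums and direct summands; $\underline{\mathcal A}=\mathcal A/\langle\mathcal T\rangle$ the stable category. For $\mathcal T$ functorially finite, $\underline{\mathcal A}$ is pretriangulated: left triangles $\Omega Y\to Z\to X\xrightarrow{\overline f}Y$ with $\Omega Y=\ker p_Y$ for a $\mathcal T$-precover $p_Y$ and $Z$ the pullback of $f$ and $p_Y$; right triangles $X\xrightarrow{\overline f}Y\to W\to\Sigma X$ with $\Sigma X=\operatorname{cok}\mu^X$ for a $\mathcal T$-preenvelope $\mu^X$ and $W$ the pushout of $f$ and $\mu^X$. $\overline f$ is a strong monomorphism if there is a left triangle $\Omega Y\to0\to X\xrightarrow{\overline f}Y$, and a strong epimorphism if there is a right triangle $X\xrightarrow{\overline f}Y\to0\to\Sigma X$. *)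

(* Defs.v *)
(* abelian categories are set up from scratch (no category
   theory library is installed).  Composition is written in DIAGRAMMATIC order:
   [comp f g] is "first f, then g" (i.e. g ∘ f). *)
From HB Require Import structures.
From mathcomp Require Import all_boot all_algebra.
Set Implicit Arguments. Unset Strict Implicit. Unset Printing Implicit Defensive.
Import GRing.Theory.
Local Open Scope ring_scope.

Record PreAddCat := {
  Obj : Type;
  Arr : Obj -> Obj -> zmodType;
  idm : forall A : Obj, Arr A A;
  comp : forall A B C : Obj, Arr A B -> Arr B C -> Arr A C;
  compA : forall (A B C D : Obj) (f : Arr A B) (g : Arr B C) (h : Arr C D),
      comp (comp f g) h = comp f (comp g h);
  comp1m : forall (A B : Obj) (f : Arr A B), comp (idm A) f = f;
  compm1 : forall (A B : Obj) (f : Arr A B), comp f (idm B) = f;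
  compDl : forall (A B C : Obj) (f f' : Arr A B) (g : Arr B C),
      comp (f + f') g = comp f g + comp f' g;
  compDr : forall (A B C : Obj) (f : Arr A B) (g g' : Arr B C),
      comp f (g + g') = comp f g + comp f g'
}.

Arguments Arr : clear implicits.
Arguments idm {p} A.
Arguments comp {p A B C} f g.

Section Defs.
Variable C : PreAddCat.
Local Notation OC := (Obj C).
Local Notation HC := (Arr C).

Definition is_mono (X Y : OC) (m : HC X Y) : Prop :=
  forall (W : OC) (g h : HC W X), comp g m = comp h m -> g = h.

Definition is_epi (X Y : OC) (e : HC X Y) : Prop :=
  forall (W : OC) (g h : HC Y W), comp e g = comp e h -> g = h.

Definition is_kernel (K X Y : OC) (k : HC K X) (f : HC X Y) : Prop :=
  comp k f = 0 /\
  forall (W : OC) (g : HC W X), comp g f = 0 -> exists! u : HC W K, comp u k = g.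

Definition is_cokernel (X Y Q : OC) (c : HC Y Q) (f : HC X Y) : Prop :=
  comp f c = 0 /\
  forall (W : OC) (g : HC Y W), comp f g = 0 -> exists! u : HC Q W, comp c u = g.

Definition is_biproduct (A B P : OC) (i1 : HC A P) (i2 : HC B P)
    (p1 : HC P A) (p2 : HC P B) : Prop :=
  [/\ comp i1 p1 = idm A, comp i2 p2 = idm B, comp i1 p2 = 0, comp i2 p1 = 0
    & comp p1 i1 + comp p2 i2 = idm P].

Definition is_pullback (X T0 Y Z : OC) (f : HC X Y) (p : HC T0 Y)
    (a : HC Z X) (b : HC Z T0) : Prop :=
  comp a f = comp b p /\
  forall (W : OC) (a' : HC W X) (b' : HC W T0), comp a' f = comp b' p ->
    exists! u : HC W Z, comp u a = a' /\ comp u b = b'.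

Definition is_pushout (X Y T1 W : OC) (f : HC X Y) (m : HC X T1)
    (c : HC Y W) (d : HC T1 W) : Prop :=
  comp f c = comp m d /\
  forall (V : OC) (c' : HC Y V) (d' : HC T1 V), comp f c' = comp m d' ->
    exists! u : HC W V, comp c u = c' /\ comp d u = d'.

Definition abelian : Prop :=
  [/\ (exists Z : OC, idm Z = 0),
      (forall A B : OC, exists (P : OC) (i1 : HC A P) (i2 : HC B P)
           (p1 : HC P A) (p2 : HC P B), is_biproduct i1 i2 p1 p2),
      (forall (X Y : OC) (f : HC X Y),
           (exists (K : OC) (k : HC K X), is_kernel k f) /\
           (exists (Q : OC) (c : HC Y Q), is_cokernel c f)),
      (forall (X Y : OC) (m : HC X Y), is_mono m ->
           exists (Q : OC) (c : HC Y Q), is_kernel m c)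
    & (forall (X Y : OC) (e : HC X Y), is_epi e ->
           exists (K : OC) (k : HC K X), is_cokernel e k)].

Definition additive_closed (T : OC -> Prop) : Prop :=
  [/\ (forall Z : OC, idm Z = 0 -> T Z),
      (forall (A B P : OC) (i1 : HC A P) (i2 : HC B P) (p1 : HC P A) (p2 : HC P B),
          is_biproduct i1 i2 p1 p2 -> T A -> T B -> T P)
    & (forall (A B : OC) (s : HC A B) (r : HC B A),
          comp s r = idm A -> T B -> T A)].

Definition projective (P : OC) : Prop :=
  forall (A B : OC) (e : HC A B), is_epi e ->
    forall g : HC P B, exists h : HC P A, comp h e = g.

Definition is_precover (T : OC -> Prop) (T0 Y : OC) (p : HC T0 Y) : Prop :=
  T T0 /\ forall (T1 : OC) (g : HC T1 Y), T T1 -> exists h : HC T1 T0, comp h p = g.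

Definition is_preenvelope (T : OC -> Prop) (X T0 : OC) (m : HC X T0) : Prop :=
  T T0 /\ forall (T1 : OC) (g : HC X T1), T T1 -> exists h : HC T0 T1, comp m h = g.

Definition functorially_finite (T : OC -> Prop) : Prop :=
  forall Y : OC,
    (exists (T0 : OC) (p : HC T0 Y), is_precover T p) /\
    (exists (T0 : OC) (m : HC Y T0), is_preenvelope T m).

(* Z is isomorphic to 0 in the stable category A/<T>, i.e. id_Z = 0 there,
   i.e. id_Z factors through an object of T. *)
Definition stably_zero (T : OC -> Prop) (Z : OC) : Prop :=
  exists (T0 : OC) (u : HC Z T0) (v : HC T0 Z), T T0 /\ comp u v = idm Z.

(* \overline f is a strong monomorphism: the left triangle
   ΩY -> Z -> X -> Y on \overline f (Z the pullback of f along a T-precover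
   p_Y) has Z ≅ 0 in the stable category. *)
Definition strong_mono (T : OC -> Prop) (X Y : OC) (f : HC X Y) : Prop :=
  exists (T0 : OC) (p : HC T0 Y) (Z : OC) (a : HC Z X) (b : HC Z T0),
    [/\ is_precover T p, is_pullback f p a b & stably_zero T Z].

(* \overline f is a strong epimorphism: the right triangle
   X -> Y -> W -> ΣX on \overline f (W the pushout of f along a T-preenvelope
   μ^X) has W ≅ 0 in the stable category. *)
Definition strong_epi (T : OC -> Prop) (X Y : OC) (f : HC X Y) : Prop :=
  exists (T0 : OC) (m : HC X T0) (W : OC) (c : HC Y W) (d : HC T0 W),
    [/\ is_preenvelope T m, is_pushout f m c d & stably_zero T W].

Definition ker_in (T : OC -> Prop) (X Y : OC) (f : HC X Y) : Prop :=
  exists (K : OC) (k : HC K X), is_kernel k f /\ T K.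

(* the image of g : A -> B (as the subobject ker(coker g) of B) is a direct
   summand of B *)
Definition image_is_summand (A B : OC) (g : HC A B) : Prop :=
  exists (Q : OC) (c : HC B Q) (I : OC) (m : HC I B) (r : HC B I),
    [/\ is_cokernel c g, is_kernel m c & comp m r = idm I].

Definition cond2 (T : OC -> Prop) (X Y : OC) (f : HC X Y) : Prop :=
  ker_in T f /\
  exists (TX : OC) (mu : HC X TX), is_preenvelope T mu /\
    exists (K : OC) (k : HC K X), is_kernel k f /\ image_is_summand (comp k mu).

Definition cond3 (T : OC -> Prop) (X Y : OC) (f : HC X Y) : Prop :=
  ker_in T f /\
  exists (T' X' : OC) (i1 : HC T' X) (i2 : HC X' X) (p1 : HC X T') (p2 : HC X X')
         (f' : HC X' Y),
    [/\ is_biproduct i1 i2 p1 p2, T T', comp i1 f = 0, f' = comp i2 f &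
        exists (K' : OC) (k' : HC K' X'), is_kernel k' f' /\
          forall (T1 : OC) (h : HC X' T1), T T1 -> comp k' h = 0].

End Defs.

(* Main.v *)
Require Import Defs.
From mathcomp Require Import all_boot all_algebra.
Set Implicit Arguments. Unset Strict Implicit. Unset Printing Implicit Defensive.
Import GRing.Theory.
Local Open Scope ring_scope.

(* Since T consists of projectives and f is epi, a T-precover p of Y lifts
   through f, so the pullback of f along p is ker f ⊕ T0: f is a strong
   monomorphism iff ker f ∈ T.  Dually, the pushout of f along μ^X is the
   cokernel of ker f -> X -> T^X; it is stably zero iff it is a retract of
   T^X, iff that cokernel splits, iff the image of ker f is a summand of T^X.
   For (2) <=> (3): that image I is in T, hence projective, so ker f ->> I
   splits and I becomes a summand T' of X lying inside ker f.  Conversely, in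
   a decomposition as in (3) every map from X into T restricts on ker f to a
   map factoring through T', and T' maps isomorphically onto the image. *)

Local Notation comp := Defs.comp.
Local Notation compA := Defs.compA.

Section Preadditive.
Variable C : PreAddCat.
Local Notation OC := (Obj C).
Local Notation HC := (Arr C).

Lemma comp0m (A B D : OC) (g : HC B D) : comp (0 : HC A B) g = 0.
Proof. by apply: (addrI (comp (0 : HC A B) g)); rewrite -compDl !addr0. Qed.

Lemma compm0 (A B D : OC) (g : HC A B) : comp g (0 : HC B D) = 0.
Proof. by apply: (addrI (comp g (0 : HC B D))); rewrite -compDr !addr0. Qed.

Lemma compNm (A B D : OC) (f : HC A B) (g : HC B D) : comp (- f) g = - comp f g.
Proof. by apply: (addrI (comp f g)); rewrite -compDl !subrr comp0m. Qed.

Lemma compmN (A B D : OC) (f : HC A B) (g : HC B D) : comp f (- g) = - comp f g.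
Proof. by apply: (addrI (comp f g)); rewrite -compDr !subrr compm0. Qed.

Lemma compBm (A B D : OC) (f f' : HC A B) (g : HC B D) :
  comp (f - f') g = comp f g - comp f' g.
Proof. by rewrite compDl compNm. Qed.

Lemma compmB (A B D : OC) (f : HC A B) (g g' : HC B D) :
  comp f (g - g') = comp f g - comp f g'.
Proof. by rewrite compDr compmN. Qed.

Lemma epi_of_cancel0 (A B : OC) (e : HC A B) :
  (forall (W : OC) (g : HC B W), comp e g = 0 -> g = 0) -> is_epi e.
Proof.
move=> cancel0 W g h eq_eg_eh; apply/eqP; rewrite -subr_eq0; apply/eqP/cancel0.
by rewrite compmB eq_eg_eh subrr.
Qed.

Lemma mono_comp (A B D : OC) (a : HC A B) (b : HC B D) :
  is_mono a -> is_mono b -> is_mono (comp a b).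
Proof. by move=> mono_a mono_b W g h; rewrite -!compA => /mono_b /mono_a. Qed.

Lemma kernel_mono (K X Y : OC) (k : HC K X) (f : HC X Y) :
  is_kernel k f -> is_mono k.
Proof.
case=> kf0 univ W g h eq_gk_hk.
have [|u [_ uniq_u]] := univ W (comp g k); first by rewrite compA kf0 compm0.
by rewrite -(uniq_u g erefl) (uniq_u h (esym eq_gk_hk)).
Qed.

Lemma cokernel_epi (X Y Q : OC) (c : HC Y Q) (f : HC X Y) :
  is_cokernel c f -> is_epi c.
Proof.
case=> fc0 univ W g h eq_cg_ch.
have [|u [_ uniq_u]] := univ W (comp c g); first by rewrite -compA fc0 comp0m.
by rewrite -(uniq_u g erefl) (uniq_u h (esym eq_cg_ch)).
Qed.

Lemma kernel_factor (K X Y W : OC) (k : HC K X) (f : HC X Y) (g : HC W X) :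
  is_kernel k f -> comp g f = 0 -> exists u, comp u k = g.
Proof. by case=> _ univ /univ [u [gE _]]; exists u. Qed.

Lemma cokernel_factor (X Y Q W : OC) (c : HC Y Q) (f : HC X Y) (g : HC Y W) :
  is_cokernel c f -> comp f g = 0 -> exists u, comp c u = g.
Proof. by case=> _ univ /univ [u [gE _]]; exists u. Qed.

Lemma split_cokernel_image_summand (A B Q I : OC) (g : HC A B) (c : HC B Q)
    (m : HC I B) (s : HC Q B) :
  is_cokernel c g -> is_kernel m c -> comp s c = idm Q -> image_is_summand g.
Proof.
move=> coker_c ker_m sc1.
have [r rm] : exists r, comp r m = idm B - comp c s.
  apply: kernel_factor ker_m _.
  by rewrite compBm comp1m compA sc1 compm1 subrr.
exists Q, c, I, m, r; split => //.
apply: (kernel_mono ker_m).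
by rewrite compA rm compmB compm1 -compA (proj1 ker_m) comp0m subr0 comp1m.
Qed.

Lemma image_summand_split_cokernel (A B : OC) (g : HC A B) :
  image_is_summand g ->
  exists (Q : OC) (c : HC B Q) (s : HC Q B), is_cokernel c g /\ comp s c = idm Q.
Proof.
case=> [Q [c [I [m [r [coker_c ker_m mr1]]]]]].
have [t tm] := kernel_factor ker_m (proj1 coker_c).
have [s cs] : exists s, comp c s = idm B - comp r m.
  apply: cokernel_factor coker_c _.
  by rewrite compmB compm1 -tm compA -[comp m (comp r m)]compA mr1 comp1m subrr.
exists Q, c, s; split => //; apply: (cokernel_epi coker_c).
by rewrite -compA cs compBm comp1m compA (proj1 ker_m) compm0 subr0 compm1.
Qed.

Lemma image_summand_idem (A B Q I : OC) (g : HC A B) (c : HC B Q)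
    (m : HC I B) (r : HC B I) :
  is_cokernel c g -> is_kernel m c -> comp m r = idm I -> comp g (comp r m) = g.
Proof.
move=> coker_c ker_m mr1.
have [t <-] := kernel_factor ker_m (proj1 coker_c).
by rewrite compA -[comp m (comp r m)]compA mr1 comp1m.
Qed.

Lemma pullback_kernel_retract (X Y T0 Z K : OC) (f : HC X Y) (p : HC T0 Y)
    (q : HC T0 X) (a : HC Z X) (b : HC Z T0) (k : HC K X) :
  comp q f = p -> is_pullback f p a b -> is_kernel k f ->
  exists (j : HC K Z) (rho : HC Z K), comp j rho = idm K.
Proof.
move=> qf [abE univ] ker_k.
have [|j [[ja jb] _]] := univ K k 0; first by rewrite (proj1 ker_k) comp0m.
have [rho rhok] : exists rho, comp rho k = a - comp b q.
  by apply: kernel_factor ker_k _; rewrite compBm abE compA qf subrr.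
exists j, rho; apply: (kernel_mono ker_k).
by rewrite compA rhok compmB ja -compA jb comp0m subr0 comp1m.
Qed.

Lemma biproduct_pullback (X Y T0 K Z : OC) (f : HC X Y) (p : HC T0 Y)
    (q : HC T0 X) (k : HC K X) (j1 : HC K Z) (j2 : HC T0 Z)
    (pr1 : HC Z K) (pr2 : HC Z T0) :
  comp q f = p -> is_kernel k f -> is_biproduct j1 j2 pr1 pr2 ->
  is_pullback f p (comp pr1 k + comp pr2 q) pr2.
Proof.
move=> qf ker_k [j11 j22 j12 j21 jsum].
split; first by rewrite compDl !compA (proj1 ker_k) compm0 add0r qf.
move=> W a' b' abE.
have [v vk] : exists v, comp v k = a' - comp b' q.
  by apply: kernel_factor ker_k _; rewrite compBm compA qf abE subrr.
exists (comp v j1 + comp b' j2); split.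
- rewrite !compDr !compDl !compA -![comp j1 (comp _ _)]compA.
  rewrite -![comp j2 (comp _ _)]compA j11 j12 j21 j22 !comp1m !comp0m !compm0.
  by rewrite addr0 add0r vk subrK add0r compm1.
- move=> u' [u'a u'b].
  have u'pr1 : comp u' pr1 = v.
    by apply: (kernel_mono ker_k); rewrite vk -u'a -u'b compDr !compA addrK.
  by rewrite -[u']compm1 -jsum compDr -!compA u'pr1 u'b.
Qed.

End Preadditive.

Section Subcategory.
Variables (C : PreAddCat) (T : Obj C -> Prop).
Hypothesis addT : additive_closed T.

Lemma retract_closed (A B : Obj C) (s : Arr C A B) (r : Arr C B A) :
  comp s r = idm A -> T B -> T A.
Proof. by case: addT => _ _; apply. Qed.

Lemma stably_zeroP (Z : Obj C) : stably_zero T Z <-> T Z.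
Proof.
split; first by case=> [T0 [u [v [TT0 uv]]]]; apply: retract_closed uv TT0.
by move=> TZ; exists Z, (idm Z), (idm Z); rewrite comp1m.
Qed.

End Subcategory.

Section Abelian.
Variable C : PreAddCat.
Hypothesis abC : abelian C.
Local Notation OC := (Obj C).
Local Notation HC := (Arr C).

Lemma kernel_exists (X Y : OC) (f : HC X Y) :
  exists (K : OC) (k : HC K X), is_kernel k f.
Proof. by case: abC => _ _ kc _ _; case: (kc X Y f). Qed.

Lemma cokernel_exists (X Y : OC) (f : HC X Y) :
  exists (Q : OC) (c : HC Y Q), is_cokernel c f.
Proof. by case: abC => _ _ kc _ _; case: (kc X Y f). Qed.

Lemma biproduct_exists (A B : OC) :
  exists (P : OC) (i1 : HC A P) (i2 : HC B P) (p1 : HC P A) (p2 : HC P B),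
    is_biproduct i1 i2 p1 p2.
Proof. by case: abC => _ bip _ _ _; apply: bip. Qed.

Lemma epi_cokernel_kernel (X Y K : OC) (f : HC X Y) (k : HC K X) :
  is_epi f -> is_kernel k f -> is_cokernel f k.
Proof.
move=> epi_f ker_k.
case: abC => _ _ _ _ /(_ X Y f epi_f) [K0 [k0 [k0f univ]]].
split=> [|W g kg0]; first exact: proj1 ker_k.
have [w wk] := kernel_factor ker_k k0f.
by apply: univ; rewrite -wk compA kg0 compm0.
Qed.

Lemma image_factorization (A B Q I : OC) (g : HC A B) (c : HC B Q) (m : HC I B) :
  is_cokernel c g -> is_kernel m c -> exists2 t : HC A I, comp t m = g & is_epi t.
Proof.
move=> coker_c ker_m.
have [t tm] := kernel_factor ker_m (proj1 coker_c).
exists t => //; apply: epi_of_cancel0 => W h th0.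
have [K2 [k2 ker_k2]] := kernel_exists h.
have [t' t'k2] := kernel_factor ker_k2 th0.
have mono_k2m : is_mono (comp k2 m).
  by apply: mono_comp; [exact: kernel_mono ker_k2 | exact: kernel_mono ker_m].
(* The mono [k2 m] is the kernel of its cokernel [c2]; as [c2] kills [g] it
   factors through [c], so [m] factors through [k2 m] and [k2] is split epi. *)
case: abC => _ _ _ /(_ _ _ _ mono_k2m) [Q2 [c2 ker_k2m]] _.
have [w cw] : exists w, comp c w = c2.
  apply: cokernel_factor coker_c _.
  by rewrite -tm -t'k2 [comp (comp t' k2) m]compA compA (proj1 ker_k2m) compm0.
have [s sk2m] : exists s, comp s (comp k2 m) = m.
  by apply: kernel_factor ker_k2m _; rewrite -cw -compA (proj1 ker_m) comp0m.
have sk2 : comp s k2 = idm I.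
  by apply: (kernel_mono ker_m); rewrite compA sk2m comp1m.
by rewrite -[h]comp1m -sk2 compA (proj1 ker_k2) compm0.
Qed.

Lemma split_mono_biproduct (A B : OC) (s : HC A B) (r : HC B A) :
  comp s r = idm A ->
  exists (A' : OC) (i2 : HC A' B) (p2 : HC B A'), is_biproduct s i2 r p2.
Proof.
move=> sr1.
have [A' [i2 ker_i2]] := kernel_exists r.
have [p2 p2i2] : exists p2, comp p2 i2 = idm B - comp r s.
  by apply: kernel_factor ker_i2 _; rewrite compBm comp1m compA sr1 compm1 subrr.
have mono_i2 := kernel_mono ker_i2.
exists A', i2, p2; split => //; last by rewrite p2i2 addrC subrK.
- apply: mono_i2.
  by rewrite compA p2i2 compmB compm1 -compA (proj1 ker_i2) comp0m subr0 comp1m.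
- apply: mono_i2.
  by rewrite compA p2i2 comp0m compmB compm1 -compA sr1 comp1m subrr.
- exact: proj1 ker_i2.
Qed.

Lemma pushout_cokernel (X Y T1 W K : OC) (f : HC X Y) (m : HC X T1)
    (c : HC Y W) (d : HC T1 W) (k : HC K X) :
  is_epi f -> is_kernel k f -> is_pushout f m c d -> is_cokernel d (comp k m).
Proof.
move=> epi_f ker_k [cdE univ].
split; first by rewrite compA -cdE -compA (proj1 ker_k) comp0m.
move=> V g kmg0.
have coker_f := epi_cokernel_kernel epi_f ker_k.
have [|c' fc'] := cokernel_factor coker_f (g := comp m g); first by rewrite -compA.
have [|u [[_ du] uniq_u]] := univ V c' g; first by [].
exists u; split => // u' du'; apply: uniq_u; split => //.
by apply: epi_f; rewrite -compA cdE compA du' fc'.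
Qed.

Lemma cokernel_pushout (X Y T1 W K : OC) (f : HC X Y) (m : HC X T1)
    (d : HC T1 W) (k : HC K X) :
  is_epi f -> is_kernel k f -> is_cokernel d (comp k m) ->
  exists c : HC Y W, is_pushout f m c d.
Proof.
move=> epi_f ker_k coker_d.
have [c fc] : exists c, comp f c = comp m d.
  apply: cokernel_factor (epi_cokernel_kernel epi_f ker_k) _.
  by rewrite -compA (proj1 coker_d).
exists c; split => // V c' d' fc'E.
have [|u [du uniq_u]] := proj2 coker_d V d'.
  by rewrite compA -fc'E -compA (proj1 ker_k) comp0m.
exists u; split => [|u' [_ du']]; last exact: uniq_u.
by split => //; apply: epi_f; rewrite -compA fc compA du.
Qed.

Section ProjectiveSubcategory.
Variable T : OC -> Prop.
Hypothesis addT : additive_closed T.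
Hypothesis projT : forall P : OC, T P -> projective P.

Lemma image_summand_section (A B Q I : OC) (g : HC A B) (c : HC B Q)
    (m : HC I B) (r : HC B I) :
  T B -> is_cokernel c g -> is_kernel m c -> comp m r = idm I ->
  T I /\ exists s : HC I A, comp s (comp g r) = idm I.
Proof.
move=> TB coker_c ker_m mr1.
have [t tm epi_t] := image_factorization coker_c ker_m.
have TI : T I := retract_closed addT mr1 TB.
have [s st] := projT TI epi_t (idm I).
by split=> //; exists s; rewrite -tm compA mr1 compm1 st.
Qed.

Section Epimorphism.
Variables (X Y : OC) (f : HC X Y).
Hypothesis epi_f : is_epi f.

Lemma strong_monoP : functorially_finite T -> (strong_mono T f <-> ker_in T f).
Proof.
move=> ffT; split.
  case=> [T0 [p [Z [a [b [[TT0 _] pb sz]]]]]].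
  have [K [k ker_k]] := kernel_exists f.
  have [q qf] := projT TT0 epi_f p.
  have [j [rho jrho]] := pullback_kernel_retract qf pb ker_k.
  have TZ : T Z by apply/(stably_zeroP addT).
  by exists K, k; split=> //; apply: (retract_closed addT jrho TZ).
case=> [K [k [ker_k TK]]].
have [[T0 [p [TT0 precov_p]]] _] := ffT Y.
have [q qf] := projT TT0 epi_f p.
have [Z [j1 [j2 [pr1 [pr2 bip]]]]] := biproduct_exists K T0.
exists T0, p, Z, (comp pr1 k + comp pr2 q), pr2; split => //.
  exact: biproduct_pullback qf ker_k bip.
apply/(stably_zeroP addT).
by case: addT => _ closed_sum _; apply: closed_sum bip TK TT0.
Qed.

(* [cond2 T f] and [cond3 T f] unfold to [ker_in T f /\ envelope_image_summand]
   and [ker_in T f /\ summand_decomposition]. *)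
Definition envelope_image_summand : Prop :=
  exists (TX : OC) (mu : HC X TX), is_preenvelope T mu /\
    exists (K : OC) (k : HC K X), is_kernel k f /\ image_is_summand (comp k mu).

Lemma strong_epiP : strong_epi T f <-> envelope_image_summand.
Proof.
split.
  case=> [TX [mu [W [c [d [preenv_mu po sz]]]]]].
  have [K [k ker_k]] := kernel_exists f.
  have coker_d := pushout_cokernel epi_f ker_k po.
  have [I [m ker_m]] := kernel_exists d.
  have TW : T W by apply/(stably_zeroP addT).
  have [s sd] := projT TW (cokernel_epi coker_d) (idm W).
  exists TX, mu; split=> //; exists K, k; split=> //.
  exact: split_cokernel_image_summand coker_d ker_m sd.
case=> [TX [mu [preenv_mu [K [k [ker_k summand]]]]]].
have [Q [c [s [coker_c sc1]]]] := image_summand_split_cokernel summand.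
have [c' po] := cokernel_pushout epi_f ker_k coker_c.
exists TX, mu, Q, c', c; split=> //.
by exists TX, s, c; split=> //; case: preenv_mu.
Qed.

Definition summand_decomposition : Prop :=
  exists (T' X' : OC) (i1 : HC T' X) (i2 : HC X' X) (p1 : HC X T') (p2 : HC X X')
         (f' : HC X' Y),
    [/\ is_biproduct i1 i2 p1 p2, T T', comp i1 f = 0, f' = comp i2 f &
        exists (K' : OC) (k' : HC K' X'), is_kernel k' f' /\
          forall (T1 : OC) (h : HC X' T1), T T1 -> comp k' h = 0].

Lemma image_summand_decomposition :
  envelope_image_summand -> summand_decomposition.
Proof.
case=> [TX [mu [[TTX preenv] [K [k [ker_k summand]]]]]].
case: summand => [Q [c [I [m [r [coker_c ker_m mr1]]]]]].
have [TI [s sr1]] := image_summand_section TTX coker_c ker_m mr1.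
have skmur1 : comp (comp s k) (comp mu r) = idm I.
  by rewrite compA -[comp k (comp mu r)]compA.
have [X' [i2 [p2 bip]]] := split_mono_biproduct skmur1.
have [_ i22 _ i21 _] := bip.
have [K' [k' ker_k']] := kernel_exists (comp i2 f).
exists I, X', (comp s k), i2, (comp mu r), p2, (comp i2 f); split => //.
  by rewrite compA (proj1 ker_k) compm0.
exists K', k'; split => // T1 h TT1.
have [g mug] := preenv T1 (comp p2 h) TT1.
have [u uk] : exists u, comp u k = comp k' i2.
  by apply: kernel_factor ker_k _; rewrite compA (proj1 ker_k').
have ukmur0 : comp (comp (comp u k) mu) r = 0 by rewrite uk !compA i21 compm0.
(* [h = i2 p2 h = i2 mu g], while [k mu = k mu r m] and [u k mu r = 0]. *)
have -> : comp k' h = comp u (comp (comp k mu) g).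
  by rewrite -[h]comp1m -i22 compA -mug -!compA uk.
by rewrite -(image_summand_idem coker_c ker_m mr1) -!compA ukmur0 !comp0m.
Qed.

Lemma decomposition_kernel_restriction (T' X' K K' : OC) (i1 : HC T' X)
    (i2 : HC X' X) (p1 : HC X T') (p2 : HC X X') (k : HC K X) (k' : HC K' X') :
  is_biproduct i1 i2 p1 p2 -> comp i1 f = 0 -> is_kernel k f ->
  is_kernel k' (comp i2 f) ->
  (forall (T1 : OC) (h : HC X' T1), T T1 -> comp k' h = 0) ->
  forall (T1 : OC) (h : HC X T1), T T1 -> comp k h = comp k (comp p1 (comp i1 h)).
Proof.
move=> [_ _ _ _ isum] i1f ker_k ker_k' vanish T1 h TT1.
have [v vk'] : exists v, comp v k' = comp k p2.
  apply: kernel_factor ker_k' _.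
  have p2i2 : comp p2 i2 = idm X - comp p1 i1 by rewrite -isum addrAC subrr add0r.
  rewrite !compA -[comp p2 (comp i2 f)]compA p2i2 compBm comp1m compA i1f.
  by rewrite compm0 subr0 (proj1 ker_k).
rewrite -{1}[h]comp1m -isum compDl compDr !compA -[comp k (comp p2 _)]compA -vk'.
by rewrite compA (vanish _ _ TT1) compm0 addr0.
Qed.

Lemma decomposition_image_summand (K TX : OC) (k : HC K X) (mu : HC X TX) :
  summand_decomposition -> is_kernel k f -> is_preenvelope T mu ->
  image_is_summand (comp k mu).
Proof.
case=> [T' [X' [i1 [i2 [p1 [p2 [f' [bip TT' i1f -> decomp_f']]]]]]]].
case: decomp_f' => [K' [k' [ker_k' vanish]]].
move=> ker_k [TTX preenv].
have restrict := decomposition_kernel_restriction bip i1f ker_k ker_k' vanish.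
have [Q [c coker_c]] := cokernel_exists (comp k mu).
have [I [m ker_m]] := kernel_exists c.
have [t tm epi_t] := image_factorization coker_c ker_m.
have [g mug] := preenv T' p1 TT'.
have [w wk] : exists w, comp w k = i1 by apply: kernel_factor ker_k i1f.
have [j jm] : exists j, comp j m = comp i1 mu.
  apply: kernel_factor ker_m _.
  by rewrite -wk !compA -[comp k (comp mu c)]compA (proj1 coker_c) compm0.
exists Q, c, I, m, (comp g j); split => //.
(* [m g j] is the identity on the image: test it against the epi [t]. *)
apply: (kernel_mono ker_m); rewrite comp1m !compA jm; apply: epi_t.
by rewrite -compA tm compA -[comp mu (comp g _)]compA mug -(restrict _ mu TTX).
Qed.

Lemma envelope_image_summandP :
  functorially_finite T -> (envelope_image_summand <-> summand_decomposition).
Proof.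
move=> ffT; split; first exact: image_summand_decomposition.
move=> decomp; have [_ [TX [mu preenv]]] := ffT X.
have [K [k ker_k]] := kernel_exists f.
exists TX, mu; split=> //; exists K, k; split=> //.
exact: decomposition_image_summand.
Qed.

End Epimorphism.
End ProjectiveSubcategory.
End Abelian.

Theorem corollary5p3 (C : PreAddCat) (T : Obj C -> Prop) :
  abelian C ->
  additive_closed T ->
  (forall P : Obj C, T P -> projective P) ->
  functorially_finite T ->
  forall (X Y : Obj C) (f : Arr C X Y), is_epi f ->
    ((strong_mono T f /\ strong_epi T f) <-> cond2 T f) /\
    (cond2 T f <-> cond3 T f).
Proof.
move=> abC addT projT ffT X Y f epi_f.
have monoP := strong_monoP abC addT projT epi_f ffT.
have epiP := strong_epiP abC addT projT epi_f.
have decompP := envelope_image_summandP abC addT projT f ffT.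
split; split.
- by case=> /monoP ker_f /epiP.
- by case=> /monoP mono_f /epiP.
- by case=> ker_f /decompP.
- by case=> ker_f /decompP.
Qed.
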